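(* Let $n\ge 1$ be an integer. The identification $E_B\leftrightarrow b^1_{i(B)}$, $O_B\leftrightarrow b^{i}_{i(B)}$, $B\subseteq\{2,3,\dots,n\}$ (extended $\mathbb{R}$-linearly), is an isomorphism of real algebras between $K_{0,n}$ and $\mathbb{C}^{2^{n-1}}$.
   Context: $K_{0,n}$ is the real associative algebra with unity generated by $e_1,\dots,e_n$ subject to $e_i^2=-1$ and $e_ie_j=e_je_i$ for all $i,j\in\{1,\dots,n\}$. For $A=\{i_1<\cdots<i_l\}\subseteq\{1,\dots,n\}$ put $e_A:=e_{i_1}\cdots e_{i_l}$, with $e_{\{\}}:=1$; the elements $e_A$, $A\subseteq\{1,\dots,n\}$, form a basis of $K_{0,n}$ as a real vector space (dimension $2^n$). For $U=\sum_A a_Ae_A$ with $a_A\in\mathbb{R}$, the grade-$k$ projection is $\langle U\rangle_k:=\sum_{|A|=k}a_Ae_A$ (zero if $k>n$). Operations of conjugation: for $l\in\{1,\dots,n\}$, $U\mapsto U^{(l)}$ is the linear map on $K_{0,n}$ replacing the generator $e_l$ by $-e_l$, i.e. $e_A^{(l)}=-e_A$ if $l\in A$ and $e_A^{(l)}=e_A$ if $l\notin A$. For $B=\{i_1,\dots,i_k\}\subseteq\{1,\dots,n\}$, $U^{(B)}$ denotes the result of applying the conjugations $(i_1),\dots,(i_k)$ successively (they commute), with $U^{(\{\})}:=U$. Define $f:=\frac{1}{2^{n-1}}\sum_{A\subseteq\{1,\dots,n\}}e_A\in K_{0,n}$, $$E:=\sum_{k=0}^{\lfloor n/2\rfloor}(-1)^k\langle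 f\rangle_{2k},\qquad O:=\sum_{k=0}^{\lfloor n/2\rfloor}(-1)^k\langle f\rangle_{2k+1},$$ and, for $B\subseteq\{2,3,\dots,n\}$, $E_B:=E^{(B)}$ and $O_B:=O^{(B)}$. Arrange the subsets of $\{2,3,\dots,n\}$ in lexicographic order and enumerate them, the empty set being the first; $i(B)\in\{1,\dots,2^{n-1}\}$ denotes the index of $B$ in this enumeration (so $B\mapsto i(B)$ is a bijection from the set of subsets of $\{2,\dots,n\}$ to $\{1,\dots,2^{n-1}\}$ with $i(\{\})=1$). $\mathbb{C}^{2^{n-1}}$ is the direct sum of $2^{n-1}$ copies of $\mathbb{C}$ with coordinatewise multiplication, regarded as a real algebra; $b_k^1$ is the tuple with $1$ in the $k$-th position and $0$ elsewhere, and $b_k^i$ is the tuple with the imaginary unit $i$ in the $k$-th position and $0$ elsewhere. *)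

(* Defs.v *)
From HB Require Import structures.
From mathcomp Require Import all_boot all_order all_algebra.
From mathcomp Require Import reals complex.

Set Implicit Arguments.
Unset Strict Implicit.
Unset Printing Implicit Defensive.

Import Order.TTheory GRing.Theory.

Local Open Scope ring_scope.

(* Generators are numbered from 0: [gen i], with [i : 'I_n], is e_{i+1}, and  *)
(* A \subset {1, ..., n} is a term of type {set 'I_n}.                        *)

(* An element of K_{0,n} is the family of its coordinates a_A in the basis    *)
(* (e_A).  Moving repeated generators together in e_A e_B gives               *)
(*   e_A * e_B = (-1)^|A :&: B| e_(symdiff A B),                              *)
(* which is [basisM] below; [gen_sqr], [basisE] and [K0_expand] show that the *)
(* ring so defined has the defining relations of K_{0,n} and the basis (e_A). *)
Definition K0 (R : realType) (n : nat) : Type := {ffun {set 'I_n} -> R^o}.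

HB.instance Definition _ (R : realType) (n : nat) :=
  GRing.Lmodule.copy (K0 R n) {ffun {set 'I_n} -> R^o}.

Definition symdiff (T : finType) (A B : {set T}) : {set T} :=
  [set i | (i \in A) (+) (i \in B)].

Section K0Ring.
Variables (R : realType) (n : nat).
Implicit Types (A B C D : {set 'I_n}) (U V W : K0 R n).

Definition K0_sign A B : R := (-1) ^+ #|A :&: B|.

Definition K0_delta A : K0 R n := [ffun C => (C == A)%:R].

Definition K0_mul U V : K0 R n :=
  [ffun C => \sum_A K0_sign A (symdiff A C) * U A * V (symdiff A C)].

Fact symdiffK A : involutive (symdiff A).
Proof. by move=> B; apply/setP=> i; rewrite !inE addbA addbb. Qed.

Fact symdiffC A B : symdiff A B = symdiff B A.
Proof. by apply/setP=> i; rewrite !inE addbC. Qed.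

Fact symdiffA A B C : symdiff A (symdiff B C) = symdiff (symdiff A B) C.
Proof. by apply/setP=> i; rewrite !inE addbA. Qed.

Fact symdiff0 A : symdiff set0 A = A.
Proof. by apply/setP=> i; rewrite !inE. Qed.

Fact symdiff_eq A B C : (symdiff A B == C) = (B == symdiff A C).
Proof. by rewrite -{1}(symdiffK A C) (inj_eq (inv_inj (@symdiffK A))). Qed.

Fact K0_signC A B : K0_sign A B = K0_sign B A.
Proof. by rewrite /K0_sign setIC. Qed.

Fact K0_signE A B : K0_sign A B = \prod_i (-1) ^+ ((i \in A) && (i \in B)).
Proof.
rewrite /K0_sign -prodr_const big_mkcond /=; apply: eq_bigr => i _.
by rewrite inE; case: ifP.
Qed.

Fact K0_signMr A B C : K0_sign A (symdiff B C) = K0_sign A B * K0_sign A C.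
Proof.
rewrite !K0_signE -big_split /=; apply: eq_bigr => i _; rewrite !inE.
by rewrite andb_addr signr_addb.
Qed.

Fact K0_signMl A B C : K0_sign (symdiff A B) C = K0_sign A C * K0_sign B C.
Proof. by rewrite K0_signC K0_signMr ![K0_sign C _]K0_signC. Qed.

Fact K0_sign0 A : K0_sign set0 A = 1.
Proof. by rewrite /K0_sign set0I cards0. Qed.

Fact K0_mulC : commutative K0_mul.
Proof.
move=> U V; apply/ffunP=> C; rewrite !ffunE.
rewrite (reindex_inj (inv_inj (@symdiffK C))) /=.
apply: eq_bigr => A _.
have -> : symdiff (symdiff C A) C = A by rewrite symdiffC symdiffK.
by rewrite (symdiffC C A) K0_signC mulrAC.
Qed.

Fact K0_mulA : associative K0_mul.
Proof.
move=> U V W; apply/ffunP=> D; rewrite !ffunE.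
under eq_bigr => A _ do rewrite ffunE mulr_sumr.
under [RHS]eq_bigr => C _ do rewrite ffunE mulr_sumr mulr_suml.
rewrite [RHS]exchange_big /=; apply: eq_bigr => A _.
rewrite [RHS](reindex_inj (inv_inj (@symdiffK A))) /=; apply: eq_bigr => B _.
rewrite symdiffK -symdiffA (symdiffA A B D) (symdiffC A B) -symdiffA.
set X := symdiff B (symdiff A D).
have -> : K0_sign (symdiff B A) X * (K0_sign A B * U A * V B) * W X =
          K0_sign (symdiff B A) X * K0_sign A B * (U A * V B * W X).
  by rewrite !mulrA.
have -> : K0_sign A (symdiff A D) * U A * (K0_sign B X * V B * W X) =
          K0_sign A (symdiff A D) * K0_sign B X * (U A * V B * W X).
  by rewrite -!mulrA; congr (_ * _); rewrite mulrCA.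
congr (_ * _).
have -> : K0_sign A (symdiff A D) = K0_sign A B * K0_sign A X.
  by rewrite -K0_signMr symdiffK.
by rewrite K0_signMl [K0_sign B X * _ in RHS]mulrC -[LHS]mulrA [LHS]mulrC.
Qed.

Fact K0_mul1 : left_id (K0_delta set0) K0_mul.
Proof.
move=> U; apply/ffunP=> C; rewrite ffunE (bigD1 set0) //= ffunE eqxx.
rewrite K0_sign0 !mul1r symdiff0 big1 ?addr0 // => A nA.
by rewrite ffunE (negPf nA) mulr0 mul0r.
Qed.

Fact K0_mulDl : left_distributive K0_mul +%R.
Proof.
move=> U V W; apply/ffunP=> C; rewrite !ffunE -big_split /=.
by apply: eq_bigr => A _; rewrite ffunE mulrDr mulrDl.
Qed.

Fact K0_one_neq0 : K0_delta set0 != 0.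
Proof. by apply/eqP=> /ffunP/(_ set0)/eqP; rewrite !ffunE eqxx oner_eq0. Qed.

HB.instance Definition _ := GRing.Zmodule_isComNzRing.Build (K0 R n)
  K0_mulA K0_mulC K0_mul1 K0_mulDl K0_one_neq0.

Fact K0_scalerAl (a : R) U V : a *: (U * V) = (a *: U) * V.
Proof.
apply/ffunP=> C; rewrite !ffunE /= scaler_sumr; apply: eq_bigr => A _.
by rewrite ffunE /= /GRing.scale /= !mulrA [a * _]mulrC.
Qed.

HB.instance Definition _ :=
  GRing.Lmodule_isLalgebra.Build R (K0 R n) K0_scalerAl.
HB.instance Definition _ :=
  GRing.Lalgebra_isComAlgebra.Build R (K0 R n).

End K0Ring.

Section K0Notions.
Variables (R : realType) (n : nat).
Implicit Types (A B : {set 'I_n}) (U : K0 R n).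

Definition gen (i : 'I_n) : K0 R n := K0_delta R [set i].

Definition basis A : K0 R n := \prod_(i in A) gen i.

Definition grade (k : nat) U : K0 R n :=
  \sum_(A : {set 'I_n} | #|A| == k) U A *: basis A.

Definition conj1 (l : 'I_n) U : K0 R n :=
  \sum_(A : {set 'I_n}) (if l \in A then - U A else U A) *: basis A.

Definition conjs B U : K0 R n := foldr conj1 U (enum B).

Definition felt : K0 R n := (2 ^+ n.-1)^-1 *: \sum_(A : {set 'I_n}) basis A.

Definition Eelt : K0 R n :=
  \sum_(0 <= k < (n %/ 2).+1) (-1) ^+ k *: grade (2 * k) felt.

Definition Oelt : K0 R n :=
  \sum_(0 <= k < (n %/ 2).+1) (-1) ^+ k *: grade (2 * k).+1 felt.

Definition Esub B : K0 R n := conjs B Eelt.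

Definition Osub B : K0 R n := conjs B Oelt.

End K0Notions.

Section K0Check.
Variables (R : realType) (n : nat).
Implicit Types (A B : {set 'I_n}) (U : K0 R n).

Lemma deltaM A B :
  K0_delta R A * K0_delta R B = K0_sign R A B *: K0_delta R (symdiff A B).
Proof.
apply/ffunP=> C; rewrite !ffunE (bigD1 A) //= big1 => [|D nD].
  rewrite !ffunE eqxx mulr1 addr0 symdiff_eq.
  by case: eqP => [->|_]; rewrite ?symdiffK //= ?mulr0 ?scaler0.
by rewrite ffunE (negPf nD) mulr0 mul0r.
Qed.

Lemma gen_sqr (i : 'I_n) : gen R i * gen R i = - 1.
Proof.
rewrite /gen deltaM /K0_sign setIid cards1 expr1 scaleN1r; congr (- _).
by congr (K0_delta _ _); apply/setP=> j; rewrite !inE addbb.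
Qed.

Lemma basisE A : basis R A = K0_delta R A.
Proof.
have [m] := ubnP #|A|; elim: m A => // m IHm A; rewrite ltnS => leAm.
have [->|[i Ai]] := set_0Vmem A; first by rewrite /basis big_set0.
rewrite /basis (big_setD1 i) //= -/(basis R (A :\ i)) IHm; last first.
  by move: leAm; rewrite (cardsD1 i A) Ai.
rewrite /gen deltaM /K0_sign (_ : _ :&: _ = set0); last first.
  by apply/setP=> j; rewrite !inE; case: eqP.
rewrite cards0 scale1r; congr (K0_delta _ _); apply/setP=> j; rewrite !inE.
by case: eqP => [->|].
Qed.

Lemma basisM A B :
  basis R A * basis R B = (-1) ^+ #|A :&: B| *: basis R (symdiff A B).
Proof. by rewrite !basisE deltaM. Qed.

Lemma K0_expand (a : {set 'I_n} -> R) U :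
  (U = \sum_A a A *: basis R A) <-> (forall A, U A = a A).
Proof.
have coefE C : (\sum_A a A *: basis R A) C = a C.
  rewrite sum_ffunE (bigD1 C) //= basisE !ffunE eqxx big1 => [|A nA].
    by rewrite addr0 /GRing.scale /= mulr1.
  by rewrite basisE !ffunE eq_sym (negPf nA) scaler0.
split=> [-> // | Ua]; apply/ffunP=> C; rewrite Ua.
by rewrite coefE.
Qed.

End K0Check.

Section LexEnum.
Variable n : nat.
Implicit Types A B : {set 'I_n}.

(* {2, ..., n}, as generators are numbered from 0. *)
Definition tail_gens : {set 'I_n} := [set i : 'I_n | (0 < i)%N].

(* Subsets are compared as their increasing lists of elements, in the         *)
(* dictionary order: for n = 3, the enumeration is {}, {2}, {2, 3}, {3}.      *)
Definition lex_le : rel {set 'I_n} :=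
  fun A B => ((enum A : seqlexi 'I_n) <= (enum B : seqlexi 'I_n))%O.

Definition lex_subsets : seq {set 'I_n} :=
  sort lex_le (enum (powerset tail_gens)).

Fact mem_lex_subsets B : (B \in lex_subsets) = (B \subset tail_gens).
Proof. by rewrite mem_sort mem_enum powersetE. Qed.

Fact size_lex_subsets : size lex_subsets = (2 ^ n.-1)%N.
Proof.
rewrite size_sort -cardE card_powerset; congr (2 ^ _)%N.
rewrite /tail_gens; case: n => [|m] /=.
  by apply/eqP; rewrite cards_eq0; apply/eqP/setP; case.
rewrite -[RHS](card_ord m) -(card_imset predT (@lift_inj _ (@ord0 m))).
apply: eq_card => i; rewrite inE; apply/idP/imsetP => [|[j _ ->]//].
by case: (unliftP ord0 i) => [j ->|->] // _; exists j.
Qed.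

Fact lex_index_subproof B :
  B \subset tail_gens -> (index B lex_subsets < 2 ^ n.-1)%N.
Proof. by rewrite -mem_lex_subsets -index_mem size_lex_subsets. Qed.

Definition lex_index B (sB : B \subset tail_gens) : 'I_(2 ^ n.-1) :=
  Ordinal (lex_index_subproof sB).

Lemma lex_index_inj A B (sA : A \subset tail_gens) (sB : B \subset tail_gens) :
  lex_index sA = lex_index sB -> A = B.
Proof.
move=> [eqAB]; rewrite -[A](nth_index set0 (s := lex_subsets)).
  by rewrite eqAB nth_index // mem_lex_subsets.
by rewrite mem_lex_subsets.
Qed.

Lemma lex_index0 (s0 : set0 \subset tail_gens) : lex_index s0 = 0%N :> nat.
Proof.
have lexT : transitive lex_le by move=> A B C; apply: le_trans.
have lexR : reflexive lex_le by move=> A; apply: lexx.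
have lexS : sorted lex_le lex_subsets.
  by apply: sort_sorted => A B; apply: le_total.
have in0 : set0 \in lex_subsets by rewrite mem_lex_subsets.
have lt0 : (0 < size lex_subsets)%N by rewrite size_lex_subsets expn_gt0.
have := sorted_leq_nth lexT lexR set0 lexS 0%N (index set0 lex_subsets).
rewrite !inE index_mem in0 lt0 nth_index // /lex_le enum_set0 => /(_ _ _ _).
move=> /(_ isT isT isT); rewrite Order.SeqLexiOrder.Exports.lexis0 => /eqP e0.
have h0 : nth set0 lex_subsets 0 = set0.
  by apply/setP=> i; rewrite -mem_enum e0 inE.
rewrite /= -[in LHS]h0 index_uniq // sort_uniq; exact: enum_uniq.
Qed.

End LexEnum.

(* The real algebra C^(2^(n-1)), with coordinatewise operations: [Rcomplex R] *)
(* is the copy of R[i] that carries its structure of algebra over R.          *)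
Notation Cpow R n := {ffun 'I_(2 ^ n.-1) -> Rcomplex R}.

Section Identification.
Variables (R : realType) (n : nat).
Implicit Types (k : 'I_(2 ^ n.-1)).

Definition b1 k : Cpow R n := [ffun j => if j == k then 1 else 0].

Definition bi k : Cpow R n :=
  [ffun j => if j == k then Complex (0 : R) 1 : Rcomplex R else 0].

Definition identifies (phi : K0 R n -> Cpow R n) : Prop :=
  forall (B : {set 'I_n}) (sB : B \subset tail_gens n),
    phi (Esub R B) = b1 (lex_index sB) /\ phi (Osub R B) = bi (lex_index sB).

End Identification.

(* Main.v *)
Require Import Defs.
From HB Require Import structures.
From mathcomp Require Import all_boot all_order all_algebra.
From mathcomp Require Import reals complex ring.
Set Implicit Arguments.
Unset Strict Implicit.
Unset Printing Implicit Defensive.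
Import GRing.Theory.
Local Open Scope ring_scope.

(** [K_{0,n}] is commutative and each generator squares to -1, so an algebra
    morphism to the complex numbers sends every generator to i or to -i.  For
    a set [B] of indices let [ev B] be the morphism sending [e_l] to -i when
    [l] is in [B] and to i otherwise; on the basis its values are
      chi_B(e_A) = (-1)^|A :&: B| i^|A|   ([char]).
    Complementing [B] conjugates [ev B], so up to conjugation there remain the
    [2^(n-1)] morphisms with [B] inside {2, ..., n}, one for each
    complex coordinate.  The isomorphism is [spectrum], the tuple of these
    evaluations.

    The elements [E_C] and [O_C] are the dual family.  The signs [(-1)^k] in
    their definition are the real parts of [i^(2k)] and the imaginary parts of
    [i^(2k+1)], and the conjugation [(C)] multiplies the coordinate at [e_A]
    by [(-1)^|A :&: C|]; therefore the coordinates of [E_C] and [O_C] at [e_A]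
    are the real and imaginary parts of [chi_C(e_A) / 2^(n-1)].  Everything
    then reduces to the orthogonality of the sign characters of the group of
    subsets under symmetric difference ([sum_sign]), used twice.

    - Summing over [A] gives [ev B E_C = [B = C]] and [ev B O_C = [B = C] i]
      ([ev_Esub], [ev_Osub]), hence a right inverse of [spectrum], the map
      [synthesis] that recombines a tuple along the [E_C] and [O_C].
    - Summing over [B] inside {2, ..., n} recovers the coordinates of [U] from
      the values [ev B U] ([coord_from_ev]), hence injectivity.

    The inverse [synthesis] mentions only the elements [E_B] and [O_B], which
    also forces the uniqueness of the linear extension. *)

(** * Powers of the imaginary unit *)

Section PowersOfI.
Variable R : realType.

Lemma scalecAr (a : R) (z w : Rcomplex R) : a *: (z * w) = z * (a *: w).
Proof. by rewrite mulrC scalerAl mulrC. Qed.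

Definition imagi : Rcomplex R := Complex 0 1.

Lemma imagi_sqr : imagi * imagi = - 1.
Proof.
apply/eqP; rewrite eq_complex /= !mulr0 !mul0r mulr1 addr0 sub0r oppr0.
by rewrite !eqxx.
Qed.

Lemma imagiX m : imagi ^+ m =
  Complex ((~~ odd m)%:R * (-1) ^+ m./2) ((odd m)%:R * (-1) ^+ m./2).
Proof.
elim: m => [|m IHm].
  by apply/eqP; rewrite eq_complex !expr0 /= mul1r mul0r !eqxx.
rewrite exprS IHm; apply/eqP; rewrite eq_complex /= uphalf_half.
case: (odd m); rewrite /= ?add0n ?add1n ?exprS ?mul0r ?mul1r ?mulr0 ?addr0.
  by rewrite sub0r mulN1r !eqxx.
by rewrite subrr add0r !eqxx.
Qed.

(** Multiplying [i^m] by its real part kills the odd powers and turns the even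
    ones into 1: this is the indicator of even [m], written as an average of
    the two characters 1 and [(-1)^m] so that sums over [m = |A|] become sums
    of sign characters. *)
Lemma Re_scale_imagiX m :
  Re (imagi ^+ m) *: imagi ^+ m = ((1 + (-1) ^+ m) / 2) *: (1 : Rcomplex R).
Proof.
have n2 : (2 : R) != 0 by rewrite Num.Theory.pnatr_eq0.
rewrite imagiX -[(-1) ^+ m]signr_odd; apply/eqP; rewrite eq_complex /=.
case: (odd m) => /=.
  by rewrite !mul0r expr1 subrr !mul0r !eqxx.
by rewrite mul1r mul0r !mulr0 expr0 divff // -expr2 sqrr_sign mulr1 !eqxx.
Qed.

Lemma Im_scale_imagiX m :
  Im (imagi ^+ m) *: imagi ^+ m = ((1 - (-1) ^+ m) / 2) *: imagi.
Proof.
have n2 : (2 : R) != 0 by rewrite Num.Theory.pnatr_eq0.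
rewrite imagiX -[(-1) ^+ m]signr_odd; apply/eqP; rewrite eq_complex /=.
case: (odd m) => /=; last by rewrite !mul0r subrr !mul0r !eqxx.
by rewrite mul0r mul1r !mulr0 opprK divff // -expr2 sqrr_sign mulr1 !eqxx.
Qed.

(** The real inner product [Re (z^* w)] of the complex plane. *)
Definition cdot (z w : Rcomplex R) : R := Re z * Re w + Im z * Im w.

Lemma cdot_imagiX a b :
  cdot (imagi ^+ a) (imagi ^+ b) =
  (odd a == odd b)%:R * ((-1) ^+ a./2 * (-1) ^+ b./2).
Proof.
rewrite /cdot !imagiX /=.
case: (odd a); case: (odd b) => /=;
  by rewrite ?mul1r ?mul0r ?mulr0 ?addr0 ?add0r.
Qed.

Lemma cdotZ (a b : R) (z w : Rcomplex R) :
  cdot (a *: z) (b *: w) = a * b * cdot z w.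
Proof. by rewrite /cdot !linearZ /=; ring. Qed.

Lemma cdot_sumr (z : Rcomplex R) (I : finType) (P : pred I) (a : I -> R)
    (w : I -> Rcomplex R) :
  cdot z (\sum_(i | P i) a i *: w i) = \sum_(i | P i) a i * cdot z (w i).
Proof.
rewrite /cdot (raddf_sum (@Re R)) (raddf_sum (@Im R)) !mulr_sumr -big_split.
by apply: eq_bigr => i _ /=; rewrite !linearZ /=; ring.
Qed.

End PowersOfI.

(** * Orthogonality of the sign characters *)

Section SignSums.
Variables (R : realType) (n : nat).
Implicit Types (A B C D S : {set 'I_n}).
Local Notation sg := (@K0_sign R n).

Lemma K0_sign1 (i : 'I_n) D : sg [set i] D = (-1) ^+ (i \in D).
Proof.
rewrite /K0_sign; have [iD|niD] := boolP (i \in D).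
  by rewrite (setIidPl _) ?cards1 ?sub1set.
rewrite (_ : _ :&: _ = set0) ?cards0 //; apply/setP=> j; rewrite !inE.
by case: eqP => // ->; rewrite (negPf niD).
Qed.

Lemma symdiff_eq0 A B : (symdiff A B == set0) = (A == B).
Proof.
rewrite symdiff_eq eq_sym; congr (_ == _).
by rewrite symdiffC symdiff0.
Qed.

(** The sign [(-1)^|B :&: D|] is a character of the group of subsets [B] of
    [S] under symmetric difference, trivial exactly when [D] misses [S]; a
    nontrivial character sums to zero. *)
Lemma sum_sign S D :
  \sum_(B : {set 'I_n} | B \subset S) sg B D
  = (S :&: D == set0)%:R * 2 ^+ #|S|.
Proof.
have [/eqP SD0|] := boolP (S :&: D == set0).
  rewrite mul1r -natrX -card_powerset -sumr_const.
  under [RHS]eq_bigl do rewrite powersetE.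
  apply: eq_bigr => B sBS; rewrite /K0_sign.
  have /eqP -> : B :&: D == set0 by rewrite -subset0 -SD0 setSI.
  by rewrite cards0.
case/set0Pn=> i; rewrite inE => /andP[iS iD]; rewrite mul0r.
(* Toggling the membership of i permutes the subsets of S and flips signs. *)
set T := \sum_(_ | _) _.
suff : T = - T.
  by move/eqP; rewrite -addr_eq0 -mulr2n Num.Theory.mulrn_eq0 => /eqP.
rewrite {1}/T (reindex_inj (inv_inj (@symdiffK n [set i]))) /= /T -sumrN.
apply: eq_big => [B|B _]; last by rewrite K0_signMl K0_sign1 iD expr1 mulN1r.
apply/subsetP/subsetP => sBS j.
  by case: (eqVneq j i) => [->//|nji jB]; apply: sBS; rewrite !inE (negPf nji).
by rewrite !inE; case: eqP => [->//|_]; apply: sBS.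
Qed.

Lemma sum_signT D : \sum_A sg D A = (D == set0)%:R * 2 ^+ n.
Proof.
under eq_bigr => A _ do rewrite K0_signC.
have := sum_sign setT D; rewrite setTI cardsT card_ord => <-.
by apply: eq_bigl => A; rewrite subsetT.
Qed.

End SignSums.

(** * Coordinates of the elements E and O *)

Section Coordinates.
Variables (R : realType) (n : nat).
Implicit Types (A B C : {set 'I_n}) (U : K0 R n).
Local Notation sg := (@K0_sign R n).

Lemma sum_basis_coord (a : {set 'I_n} -> R) C :
  (\sum_A a A *: basis R A) C = a C.
Proof. by have /K0_expand := erefl (\sum_A a A *: basis R A). Qed.

Lemma conj1_coord (l : 'I_n) U A : conj1 l U A = sg [set l] A * U A.
Proof.
rewrite sum_basis_coord K0_sign1.
by case: (l \in A); rewrite ?expr1 ?expr0 ?mulN1r ?mul1r.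
Qed.

Lemma conjs_coord B U A : conjs B U A = sg B A * U A.
Proof.
have sgE : sg B A = \prod_(l <- enum B) sg [set l] A.
  rewrite K0_signE big_enum [RHS]big_mkcond; apply: eq_bigr => l _.
  by rewrite K0_sign1; case: (l \in B).
rewrite sgE /conjs; elim: (enum B) => [|l s IHs] /=.
  by rewrite big_nil mul1r.
by rewrite conj1_coord IHs big_cons mulrA.
Qed.

Lemma grade_coord k U A : grade k U A = (#|A| == k)%:R * U A.
Proof.
rewrite /grade big_mkcond.
rewrite (eq_bigr (fun C => ((#|C| == k)%:R * U C) *: basis R C)).
  exact: sum_basis_coord.
by move=> C _; case: eqP; rewrite ?mul1r ?mul0r ?scale0r.
Qed.

Lemma felt_coord A : felt R n A = (2 ^+ n.-1)^-1.
Proof.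
rewrite /felt scaler_sumr.
exact: (sum_basis_coord (fun=> _)).
Qed.

(** At [e_A] at most one grade contributes, the one with [k = |A|./2], and it
    lies in the range of summation because [|A| <= n].  The boolean [d] selects
    the even grades ([false]) or the odd ones ([true]). *)
Lemma alternating_grades_coord (d : bool) U A :
  (\sum_(0 <= k < (n %/ 2).+1) (-1) ^+ k *: grade (d + 2 * k) U) A
  = (odd #|A| == d)%:R * (-1) ^+ #|A|./2 * U A.
Proof.
rewrite sum_ffunE big_mkord.
under eq_bigr => k _ do rewrite ffunE /= grade_coord.
have [oA|nA] := eqVneq (odd #|A|) d; last first.
  rewrite !mul0r big1 // => k _.
  have /negPf -> : #|A| != (d + 2 * k)%N.
    by apply: contraNneq nA => ->; rewrite oddD mul2n odd_double addbF oddb.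
  by rewrite mul0r scaler0.
have Ak : #|A| = (d + 2 * #|A|./2)%N by rewrite mul2n -oA odd_double_half.
have lt : (#|A|./2 < (n %/ 2).+1)%N.
  by rewrite ltnS divn2 half_leq // -[X in (_ <= X)%N]card_ord max_card.
rewrite (bigD1 (Ordinal lt)) //= -Ak eqxx big1 ?addr0 ?mul1r //.
move=> k nk.
have /negPf -> : #|A| != (d + 2 * k)%N.
  by apply: contra nk; rewrite -val_eqE /= {1}Ak eqn_add2l eqn_pmul2l // eq_sym.
by rewrite mul0r scaler0.
Qed.

Lemma Eelt_coord A : Eelt R n A = (2 ^+ n.-1)^-1 * Re (imagi R ^+ #|A|).
Proof.
rewrite imagiX mulrC -(felt_coord A) /= -eqbF_neg.
exact: (alternating_grades_coord false).
Qed.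

Lemma Oelt_coord A : Oelt R n A = (2 ^+ n.-1)^-1 * Im (imagi R ^+ #|A|).
Proof.
rewrite imagiX mulrC -(felt_coord A) /= -[odd _]eqb_id.
exact: (alternating_grades_coord true).
Qed.

End Coordinates.

(** * The morphisms to the complex numbers *)

Section Characters.
Variables (R : realType) (n : nat).
Implicit Types (A B C : {set 'I_n}) (U V : K0 R n).
Local Notation sg := (@K0_sign R n).

Definition char B A : Rcomplex R := sg B A *: imagi R ^+ #|A|.

Lemma card_symdiff A B : (#|A| + #|B| = #|symdiff A B| + 2 * #|A :&: B|)%N.
Proof.
have -> : symdiff A B = (A :|: B) :\: (A :&: B).
  by apply/setP=> i; rewrite !inE; case: (i \in A); case: (i \in B).
rewrite cardsDS ?subIset ?subsetUl // -cardsUI mul2n -addnn addnA subnK //.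
by apply: subset_leq_card; rewrite subIset ?subsetUl.
Qed.

(** [char B] turns the product of [e_A] and [e_D] into a product: moving from
    [|symdiff A D|] to [|A| + |D|] costs [i^(2 |A :&: D|)], which is the sign
    of that product. *)
Lemma char_symdiff B A D : sg A D *: char B (symdiff A D) = char B A * char B D.
Proof.
rewrite /char -scalerAl -scalecAr -exprD card_symdiff exprD exprM expr2.
rewrite imagi_sqr K0_signMr scalerA scalerA /K0_sign.
have -> : (-1) ^+ #|A :&: D| = ((-1) ^+ #|A :&: D|)%:A :> Rcomplex R.
  rewrite -[LHS]signr_odd -[in RHS]signr_odd; case: odd;
    by rewrite ?expr1 ?scaleN1r ?expr0 ?scale1r.
by rewrite -scalecAr mulr1 scalerA [in RHS]mulrC mulrA.
Qed.

Definition ev B U : Rcomplex R := \sum_A U A *: char B A.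

Lemma ev_linear B (a : R) U V : ev B (a *: U + V) = a *: ev B U + ev B V.
Proof.
rewrite /ev scaler_sumr -big_split; apply: eq_bigr => A _ /=.
by rewrite !ffunE scalerDl [in RHS]scalerA.
Qed.

Lemma ev1 B : ev B 1 = 1.
Proof.
rewrite /ev (bigD1 set0) //= ffunE eqxx scale1r big1.
  by rewrite addr0 /char K0_signC K0_sign0 scale1r cards0 expr0.
by move=> A nA; rewrite ffunE (negPf nA) scale0r.
Qed.

Lemma evM B U V : ev B (U * V) = ev B U * ev B V.
Proof.
rewrite /ev mulr_suml.
under eq_bigr => C _ do rewrite ffunE scaler_suml.
rewrite exchange_big; apply: eq_bigr => A _ /=.
rewrite (reindex_inj (inv_inj (@symdiffK n A))) mulr_sumr.
apply: eq_bigr => D _ /=.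
rewrite symdiffK -scalerAl -scalecAr -char_symdiff !scalerA.
by congr (_ *: _); ring.
Qed.

End Characters.

(** * The two orthogonality relations *)

Section Values.
Variables (R : realType) (n : nat).
Hypothesis n_gt0 : (0 < n)%N.
Implicit Types (A B C : {set 'I_n}) (U V : K0 R n).
Local Notation sg := (@K0_sign R n).

Lemma symdiff_neqT B C :
  B \subset tail_gens n -> C \subset tail_gens n -> symdiff B C != setT.
Proof.
move=> sB sC; apply/eqP=> /setP/(_ (Ordinal n_gt0)); rewrite !inE.
have nt (D : {set _}) : D \subset tail_gens n -> Ordinal n_gt0 \in D = false.
  by move=> sD; apply/negbTE/negP=> /(subsetP sD); rewrite inE.
by rewrite !nt.
Qed.

(** The sign [(-1)^|A|] is the character of the full set, so twisting by it
    replaces [D] by its complement; for [D] different from the full set that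
    twisted sum vanishes, and only the untwisted half remains. *)
Lemma half_sum_sign D (e : R) : D != setT ->
  \sum_A (2 ^+ n.-1)^-1 * (sg D A * ((1 + e * (-1) ^+ #|A|) / 2))
  = (D == set0)%:R.
Proof.
move=> nDT; rewrite -mulr_sumr.
have -> : \sum_A sg D A * ((1 + e * (-1) ^+ #|A|) / 2)
        = (\sum_A sg D A + e * \sum_A sg (symdiff D setT) A) / 2.
  rewrite mulr_sumr -big_split mulr_suml; apply: eq_bigr => A _ /=.
  by rewrite K0_signMl [sg setT A]/K0_sign setTI; ring.
rewrite !sum_signT symdiff_eq0 (negPf nDT) mul0r mulr0 addr0.
have -> : 2 ^+ n = 2 ^+ n.-1 * 2 :> R by rewrite -exprSr prednK.
have n2 : (2 : R) != 0 by rewrite Num.Theory.pnatr_eq0.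
by field; rewrite expf_neq0.
Qed.

(** [half_sum_sign] applies with [D = symdiff B C], which is never the full set
    because neither [B] nor [C] contains the first generator. *)
Lemma ev_Esub B C : B \subset tail_gens n -> C \subset tail_gens n ->
  ev B (Esub R C) = if B == C then 1 else 0.
Proof.
move=> sB sC.
transitivity ((B == C)%:R *: (1 : Rcomplex R)); last first.
  by case: eqP; rewrite ?scale1r ?scale0r.
rewrite -symdiff_eq0 -(half_sum_sign 1%R (symdiff_neqT sB sC)) scaler_suml.
apply: eq_bigr => A _; rewrite conjs_coord Eelt_coord /char mul1r.
have -> (x : Rcomplex R) (c s t : R) :
    (s * (c * Re x)) *: (t *: x) = (c * (t * s)) *: (Re x *: x).
  by rewrite !scalerA; congr (_ *: _); ring.
by rewrite Re_scale_imagiX K0_signMl scalerA; congr (_ *: _); ring.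
Qed.

Lemma ev_Osub B C : B \subset tail_gens n -> C \subset tail_gens n ->
  ev B (Osub R C) = if B == C then imagi R else 0.
Proof.
move=> sB sC.
transitivity ((B == C)%:R *: imagi R); last first.
  by case: eqP; rewrite ?scale1r ?scale0r.
rewrite -symdiff_eq0 -(half_sum_sign (-1) (symdiff_neqT sB sC)) scaler_suml.
apply: eq_bigr => A _; rewrite conjs_coord Oelt_coord /char mulN1r.
have -> (x : Rcomplex R) (c s t : R) :
    (s * (c * Im x)) *: (t *: x) = (c * (t * s)) *: (Im x *: x).
  by rewrite !scalerA; congr (_ *: _); ring.
by rewrite Im_scale_imagiX K0_signMl scalerA; congr (_ *: _); ring.
Qed.

Lemma cdot_char B A D : cdot (char R B A) (char R B D) =
  sg B (symdiff A D) * cdot (imagi R ^+ #|A|) (imagi R ^+ #|D|).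
Proof. by rewrite cdotZ K0_signMr. Qed.

(** Summing over [B] inside {2, ..., n} cannot separate [A] from [D] when they
    differ by the first generator only.  In that case [|A|] and [|D|] have
    opposite parities, so that [i^|A|] and [i^|D|] are orthogonal. *)
Lemma sum_cdot_char A D :
  \sum_(B : {set 'I_n} | B \subset tail_gens n) cdot (char R B A) (char R B D)
  = (A == D)%:R * 2 ^+ #|tail_gens n|.
Proof.
under eq_bigr => B _ do rewrite cdot_char.
rewrite -mulr_suml sum_sign cdot_imagiX.
have [->|nAD] := eqVneq A D.
  have /eqP -> : symdiff D D == set0 by rewrite symdiff_eq0.
  by rewrite setI0 !eqxx -expr2 sqrr_sign !mulr1.
rewrite mul0r; have [/eqP T0|_] := boolP (_ == set0); last by rewrite !mul0r.
have AD1 : symdiff A D = [set Ordinal n_gt0].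
  apply/eqP; rewrite eqEcard cards1 card_gt0 symdiff_eq0 nAD andbT.
  apply/subsetP=> i iAD; rewrite inE -val_eqE /= -leqn0 leqNgt.
  by apply/negP=> i_gt0; move/setP/(_ i): T0; rewrite inE iAD !inE i_gt0.
have /negPf -> : odd #|A| != odd #|D|.
  rewrite -addbT -negb_add -oddD card_symdiff AD1 cards1.
  by rewrite oddD mul2n odd_double.
by rewrite mul0r mulr0.
Qed.

(** Fourier inversion: [ev B U] is the combination of the [char B D] with
    coefficients [U D], and orthogonality singles out the term [D = A]. *)
Lemma coord_from_ev U A :
  \sum_(B : {set 'I_n} | B \subset tail_gens n) cdot (char R B A) (ev B U)
  = U A * 2 ^+ #|tail_gens n|.
Proof.
under eq_bigr => B _ do rewrite cdot_sumr.
rewrite exchange_big (bigD1 A) //= -mulr_sumr sum_cdot_char eqxx mul1r.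
rewrite big1 ?addr0 // => D nDA.
by rewrite -mulr_sumr sum_cdot_char eq_sym (negPf nDA) mul0r mulr0.
Qed.

End Values.

(** * The isomorphism *)

Section Isomorphism.
Variables (R : realType) (n : nat).

Definition lex_set (k : 'I_(2 ^ n.-1)) : {set 'I_n} :=
  nth set0 (lex_subsets n) k.

Lemma lex_set_sub k : lex_set k \subset tail_gens n.
Proof. by rewrite -mem_lex_subsets mem_nth // size_lex_subsets. Qed.

Lemma lex_set_index (B : {set _}) (sB : B \subset tail_gens n) :
  lex_set (lex_index sB) = B.
Proof. by rewrite /lex_set nth_index // mem_lex_subsets. Qed.

Lemma lex_index_set k : lex_index (lex_set_sub k) = k.
Proof.
apply: val_inj; rewrite /= index_uniq ?size_lex_subsets //.
by rewrite sort_uniq enum_uniq.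
Qed.

Definition spectrum (U : K0 R n) : Cpow R n := [ffun k => ev (lex_set k) U].

Lemma spectrum_linear : linear spectrum.
Proof. by move=> a U V; apply/ffunP=> k; rewrite !ffunE ev_linear. Qed.

Lemma spectrum_multiplicative : monoid_morphism spectrum.
Proof.
split; first by apply/ffunP=> k; rewrite !ffunE ev1.
by move=> U V; apply/ffunP=> k; rewrite !ffunE evM.
Qed.

HB.instance Definition _ :=
  GRing.isLinear.Build R (K0 R n) (Cpow R n) _ spectrum spectrum_linear.
HB.instance Definition _ :=
  GRing.isMonoidMorphism.Build (K0 R n) (Cpow R n) spectrum
    spectrum_multiplicative.

Hypothesis n_gt0 : (0 < n)%N.

Lemma spectrum_identifies : identifies spectrum.
Proof.
move=> B sB; split; apply/ffunP=> k; rewrite !ffunE.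
  rewrite ev_Esub ?lex_set_sub // -{2}[k]lex_index_set.
  congr (if _ then _ else _); apply/eqP/eqP => [eB|/lex_index_inj //].
  by apply: val_inj; rewrite /= eB.
rewrite ev_Osub ?lex_set_sub // -{2}[k]lex_index_set.
congr (if _ then _ else _); apply/eqP/eqP => [eB|/lex_index_inj //].
by apply: val_inj; rewrite /= eB.
Qed.

Definition synthesis (z : Cpow R n) : K0 R n :=
  \sum_k (Re (z k) *: Esub R (lex_set k) + Im (z k) *: Osub R (lex_set k)).

(** The statement is about any linear map with the prescribed values, because it
    serves both for surjectivity and for uniqueness. *)
Lemma identifies_synthesis (psi : {linear K0 R n -> Cpow R n}) :
  identifies psi -> cancel synthesis psi.
Proof.
move=> psi_id z; rewrite /synthesis raddf_sum.
apply/ffunP=> j; rewrite sum_ffunE (bigD1 j) //= big1 => [|k nkj].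
  rewrite linearD !linearZ /=.
  have [-> ->] := psi_id _ (lex_set_sub j).
  rewrite addr0 lex_index_set !ffunE eqxx.
  case: (z j) => a b; apply/eqP.
  by rewrite eq_complex /= !mulr0 !mulr1 addr0 add0r !eqxx.
rewrite linearD !linearZ /=; have [-> ->] := psi_id _ (lex_set_sub k).
by rewrite lex_index_set !ffunE eq_sym (negPf nkj) !scaler0 addr0.
Qed.

Lemma spectrum_inj : injective spectrum.
Proof.
move=> U V eqUV; apply/ffunP=> A.
have n2 : (2 : R) ^+ #|tail_gens n| != 0.
  by rewrite expf_neq0 // Num.Theory.pnatr_eq0.
apply: (mulIf n2); rewrite -!(coord_from_ev n_gt0); apply: eq_bigr => B sB.
have := congr1 (fun z : Cpow R n => z (lex_index sB)) eqUV.
by rewrite !ffunE lex_set_index => ->.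
Qed.

Lemma spectrumK : cancel spectrum synthesis.
Proof.
move=> U; apply: spectrum_inj.
exact: (identifies_synthesis spectrum_identifies).
Qed.

End Isomorphism.

Theorem theorem6p11 (R : realType) (n : nat) (hn : (1 <= n)%N) :
  exists phi : {lrmorphism K0 R n -> Cpow R n},
    [/\ identifies phi,
        (forall psi : {linear K0 R n -> Cpow R n},
           identifies psi -> psi =1 phi)
      & bijective phi].
Proof.
have phi_id := spectrum_identifies R hn.
exists (@spectrum R n : {lrmorphism K0 R n -> Cpow R n}).
split=> // [psi psi_id U|].
  rewrite -[U in LHS](spectrumK hn).
  exact: (identifies_synthesis psi_id).
exists (@synthesis R n); first exact: spectrumK.
exact: (identifies_synthesis phi_id).
Qed.
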